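(* Let $F$ be a finite extension of $\mathbb{Q}_p$, $n\geq2$, $G=\mathrm{PGL}_n$, and $\mu$ the minuscule cocharacter induced by $(1,0^{n-1})$ (the case $d=1$), so that $X=\mathcal{F}\ell(G,\mu)=\mathbb{P}^{n-1}$ and $X^{b_0}=X^s=\Omega^n$ is the Drinfeld space. Then the retraction map $r:\Omega^n\to\mathcal{B}(G,F)$ coincides with the Drinfeld retraction $r^{Dr}$ defined in terms of norms.
   Context: **Setting.** Let $V=F^n$, $G=\mathrm{PGL}(V)$, $X=\mathbb{P}(V)$ the space of lines in $V$. $\Omega^n\subset X^{\mathrm{Berk}}$ is the complement of the union of all $F$-rational hyperplanes; it equals the stable locus $X^s=\bigcap_TX(T,\mathcal{L})^{s,\mathrm{Berk}}$, where $T$ runs over all maximal split tori of $G$, $\mathcal{L}$ is a $G$-linearized sufficiently divisible power of $\mathcal{O}(1)$, and $X(T,\mathcal{L})^s\subset X$ is the open locus of GIT (properly) stable (here $=$ semistable) points for the $T$-action, i.e. the union of the non-vanishing loci of $T$-invariant sections of powers of $\mathcal{L}$. **Apartment retraction $r_A$, $A=A_T$.** Choose a special vertex $o$ in the apartment $A_T\subset\mathcal{B}(G,F)$ of $T$. It defines a reductive model of $G$ over $O_F$; $T$, $X$, $\mathcal{L}$ and $X(T,\mathcal{L})^s$ extend over $O_F$. Let $K|F$ be an algebraically closed complete non-archimedean extension, $v:K^*\to\mathbb{R}$ the additive valuation with $v(\pi)=1$ ($\pi$ a uniformizer of $F$), and $v_T:T(K)\cong\mathrm{Hom}(X^*(T),K^*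 )\to\mathrm{Hom}(X^*(T),\mathbb{R})$. Identify $A_T$ with $\mathrm{Hom}(X^*(T),\mathbb{R})$ with origin $o$, where (Tits's sign convention) $t$ acts on $A_T$ by translation by $-v_T(t)$. Every $x\in X(T,\mathcal{L})^s(K)$ is $t\cdot y$ with $t\in T(K)$, $y\in X(T,\mathcal{L})^s(O_K)$, and $r_A(x):=-v_T(t)$ is well defined. Letting $K$ vary gives $r_A:X(T,\mathcal{L})^{s,\mathrm{Berk}}\to A_T$, independent of $o$. **The retraction map.** For $z\in\mathcal{B}(G,F)$ put $Y_z=\bigcap_{A\ni z}r_A^{-1}(z)$, over all apartments $A$ containing $z$. One has $X^s=\coprod_{z\in\mathcal{B}(G,F)}Y_z$, and $r:X^s=\Omega^n\to\mathcal{B}(G,F)$ sends every point of $Y_z$ to $z$. **Drinfeld retraction.** $\mathcal{B}(G,F)$ is identified with the set of homothety classes of non-archimedean norms on the dual space $V^*$, on which $G(F)$ acts through the dual action. $r^{Dr}:\Omega^n\to\mathcal{B}(G,F)$ sends $x$ to the class of the norm $f\mapsto|f(x)|$ on $V^*$, i.e. $\sum a_ie_i^*\mapsto|\sum a_ix_i|$ for $x=[x_1:\dots:x_n]$ in the coordinates of a basis $e_1,\dots,e_n$ of $V$. *)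

(* Defs.v *)
From HB Require Import structures.
From mathcomp Require Import all_boot all_order all_algebra all_field.
From mathcomp Require Import boolp classical_sets reals exp.
From mathcomp Require Import mpoly.

Set Implicit Arguments.
Unset Strict Implicit.
Unset Printing Implicit Defensive.

Import Order.TTheory GRing.Theory Num.Theory.
Local Open Scope classical_set_scope.
Local Open Scope ring_scope.

(* Real-valued additive valuations K^* -> R; the value at 0 is irrelevant. *)
Definition is_valuation (R : realType) (K : fieldType) (v : K -> R) : Prop :=
  (forall x y, x != 0 -> y != 0 -> v (x * y) = v x + v y) /\
  (forall x y, x != 0 -> y != 0 -> x + y != 0 ->
     Num.min (v x) (v y) <= v (x + y)).

Definition val_gt (R : realType) (K : fieldType) (v : K -> R) (M : R) (x : K) :
  Prop := x = 0 \/ M < v x.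

Definition val_complete (R : realType) (K : fieldType) (v : K -> R) : Prop :=
  forall u : nat -> K,
    (forall M : R, exists k0, forall k l,
       (k0 <= k)%N -> (k0 <= l)%N -> val_gt v M (u k - u l)) ->
    exists x, forall M : R, exists k0, forall k,
      (k0 <= k)%N -> val_gt v M (u k - x).

(* (Qp, vp) is the completion of the rationals for the p-adic valuation. *)
Definition is_padic_field (R : realType) (p : nat) (Qp : fieldType)
    (vp : Qp -> R) : Prop :=
  [/\ is_valuation vp,
      forall m : nat, (0 < m)%N ->
        m%:R != 0 :> Qp /\ vp (m%:R) = (logn p m)%:R,
      forall (x : Qp) (M : R), exists a : rat, val_gt vp M (x - ratr a)
    & val_complete vp].

(* v is the extension of vp to F, rescaled so that v(F^* ) = Z; the factor e
   is the ramification index. *)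
Definition is_normalized_extension (R : realType) (Qp : fieldType)
    (vp : Qp -> R) (F : fieldExtType Qp) (v : F -> R) : Prop :=
  [/\ is_valuation v,
      forall x, x != 0 -> exists k : int, v x = k%:~R,
      exists2 x, x != 0 & v x = 1
    & exists2 e : nat, (0 < e)%N &
        forall a : Qp, a != 0 -> v (a%:A) = e%:R * vp a].

(* The absolute value |x| = q^(-v(x)), for a fixed base q > 1. *)
Definition vabs (R : realType) (q : R) (K : fieldType) (v : K -> R) (x : K) : R :=
  if x == 0 then 0 else q `^ (- v x).

Section Retractions.

Variables (R : realType) (F : fieldType) (v : F -> R) (q : R) (n N : nat).

(* Vectors of V = F^n are columns, linear forms on V are rows. A basis of V is
   an invertible matrix e, with columns e_1, ..., e_n; the coordinates of x in
   it are the entries of e^-1 x, and those of a form f in the dual basis are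
   the entries of f e. *)

Definition is_norm (al : 'rV[F]_n -> R) : Prop :=
  [/\ forall f, 0 <= al f,
      forall f, al f = 0 <-> f = 0,
      forall a f, al (a *: f) = vabs q v a * al f
    & forall f g, al (f + g) <= Num.max (al f) (al g)].

Definition homothety_class (al : 'rV[F]_n -> R) : set ('rV[F]_n -> R) :=
  [set be | exists2 c : R, 0 < c & forall f, be f = c * al f].

Definition building : set (set ('rV[F]_n -> R)) :=
  [set z | exists2 al, is_norm al & z = homothety_class al].

Definition diagonalizes (e : 'M[F]_n) (T : set 'M[F]_n) : Prop :=
  e \in unitmx /\ forall t, T t -> is_diag_mx (invmx e *m t *m e).

(* T stands for the inverse image in GL(V)(F) of the group of F-points of a
   split torus of PGL(V). Connectedness is not imposed: it is automatic for
   the maximal groups, the only ones used. *)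
Definition split_group (T : set 'M[F]_n) : Prop :=
  [/\ forall t, T t -> t \in unitmx,
      T 1%:M,
      forall t u, T t -> T u -> T (t *m u),
      forall t, T t -> T (invmx t)
    & exists e, diagonalizes e T].

Definition max_split_torus (T : set 'M[F]_n) : Prop :=
  split_group T /\
  forall T', split_group T' -> T `<=` T' -> T' `<=` T.

(* A basis e diagonalizing T determines a special vertex o of the apartment of
   T, the class of the norm with unit ball spanned by the dual basis, and every
   special vertex of the apartment is obtained in this way. An element of
   Hom(X^*(T), R) = R^n / R(1, ..., 1) is given by a representative la. The
   identification of Hom(X^*(T), R) with the apartment which sends 0 to o and
   for which t acts by translation by - v_T(t) is apt_point e; see
   apt_point_translation below. *)
Definition apt_norm (e : 'M[F]_n) (la : 'I_n -> R) (f : 'rV[F]_n) : R :=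
  \big[Num.max/0]_(i < n) (vabs q v ((f *m e) 0 i) * q `^ (la i)).

Definition apt_point (e : 'M[F]_n) (la : 'I_n -> R) : set ('rV[F]_n -> R) :=
  homothety_class (apt_norm e la).

Definition apartment (T : set 'M[F]_n) : set (set ('rV[F]_n -> R)) :=
  [set z | exists e la, diagonalizes e T /\ z = apt_point e la].

Record cc_extension := CCExtension {
  ext_field :> closedFieldType;
  ext_inj : {rmorphism F -> ext_field};
  ext_val : ext_field -> R;
  _ : is_valuation ext_val;
  _ : forall a, a != 0 -> ext_val (ext_inj a) = v a;
  _ : val_complete ext_val
}.

Definition ext_abs (K : cc_extension) : K -> R := vabs q (@ext_val K).

Definition ext_mx (K : cc_extension) (m1 m2 : nat) (A : 'M[F]_(m1, m2)) :
  'M[K]_(m1, m2) := map_mx (@ext_inj K) A.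

(* Polynomials are functions on V through the coordinates in a basis e. *)
Definition peval (e : 'M[F]_n) (f : {mpoly F[n]}) (x : 'cV[F]_n) : F :=
  meval (fun i => (invmx e *m x) i 0) f.

Definition ext_peval (K : cc_extension) (e : 'M[F]_n) (f : {mpoly F[n]})
    (x : 'cV[K]_n) : K :=
  meval (fun i => (invmx (ext_mx K e) *m x) i 0)
    (map_mpoly (@ext_inj K) f).

(* Homogeneous coordinates of a point of P(V)(K). *)
Record geom_point := GeomPoint {
  gp_ext : cc_extension;
  gp_vec : 'cV[gp_ext]_n;
  _ : gp_vec != 0
}.

(* The point of the Berkovich space induced by x: the multiplicative seminorm
   f |-> |f(x)| on the homogeneous coordinate ring F[V], up to the rescaling
   f |-> c^deg(f) |f(x)|. Only the values at homogeneous f matter. Every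
   point of the Berkovich space is induced by a point over some algebraically
   closed complete K, and two points of P(V) over possibly different K induce
   the same one exactly when these classes agree. *)
Definition berk_point (x : geom_point) : set ({mpoly F[n]} -> R) :=
  [set s | exists2 c : R, 0 < c &
     forall (d : nat) (f : {mpoly F[n]}), f \is d.-homog ->
       s f = c ^+ d * ext_abs (ext_peval 1%:M f (gp_vec x))].

Definition berk : set (set ({mpoly F[n]} -> R)) :=
  [set xi | exists x, xi = berk_point x].

Definition omega : set (set ({mpoly F[n]} -> R)) :=
  [set xi | berk xi /\ forall x, xi = berk_point x ->
     forall f : 'rV[F]_n, f != 0 -> ext_mx (gp_ext x) f *m gp_vec x != 0].

Definition drinfeld_retraction (xi : set ({mpoly F[n]} -> R)) : set ('rV[F]_n -> R) :=
  [set be | exists2 x, xi = berk_point x &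
     homothety_class
       (fun f => ext_abs ((ext_mx (gp_ext x) f *m gp_vec x) 0 0)) be].

(* Sections of L^k, for L = O(N) with n | N, are the homogeneous polynomials of
   degree k N; for the PGL(V)-linearization of L, the class of g acts on them
   by f |-> det(g)^(k N / n) (f o g^-1), on which scalars are trivial. As F is
   infinite, invariance may be tested on F-points. *)
Definition inv_section (T : set 'M[F]_n) (e : 'M[F]_n) (k : nat)
    (f : {mpoly F[n]}) : Prop :=
  f \is (k * N).-homog /\
  forall t, T t -> forall x : 'cV[F]_n,
    (\det t) ^+ ((k * N) %/ n) * peval e f (invmx t *m x) = peval e f x.

(* The K-points of the stable locus of T. *)
Definition stable (T : set 'M[F]_n) (K : cc_extension) (x : 'cV[K]_n) : Prop :=
  exists k f, [/\ (0 < k)%N, inv_section T 1%:M k f & ext_peval 1%:M f x != 0].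

(* The O_K-points of the stable locus of T over O_F, in the model P(Lambda) of
   P(V) with Lambda spanned over O_F by e: y has primitive coordinates, and
   some T-invariant section with coefficients in O_F takes a unit value at y,
   so that the closed point of Spec O_K also maps to the stable locus. *)
Definition integral_stable (T : set 'M[F]_n) (e : 'M[F]_n) (K : cc_extension)
    (y : 'cV[K]_n) : Prop :=
  [/\ forall i, ext_abs ((invmx (ext_mx K e) *m y) i 0) <= 1,
      exists i, ext_abs ((invmx (ext_mx K e) *m y) i 0) = 1
    & exists k f,
        [/\ (0 < k)%N, inv_section T e k f,
            forall m, vabs q v (f@_m) <= 1
          & ext_abs (ext_peval e f y) = 1]].

(* The element with eigenvalues d of the torus diagonalized by e. *)
Definition torus_mx (e : 'M[F]_n) (K : cc_extension) (d : 'rV[K]_n) : 'M[K]_n :=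
  ext_mx K e *m diag_mx d *m invmx (ext_mx K e).

Definition torus_stable_locus (T : set 'M[F]_n) : set (set ({mpoly F[n]} -> R)) :=
  [set xi | berk xi /\ forall x, xi = berk_point x -> stable T (gp_vec x)].

Definition stable_locus : set (set ({mpoly F[n]} -> R)) :=
  [set xi | berk xi /\ forall T, max_split_torus T -> torus_stable_locus T xi].

(* x = t y with t in T(K), y in the stable locus over O_K of the model given by
   e, and z = - v_T(t) in the apartment with origin given by e. *)
Definition retracts_to (T : set 'M[F]_n) (x : geom_point)
    (z : set ('rV[F]_n -> R)) : Prop :=
  exists (e : 'M[F]_n) (d : 'rV[gp_ext x]_n) (y : 'cV[gp_ext x]_n),
    [/\ diagonalizes e T,
        forall i, d 0 i != 0,
        integral_stable T e y,
        gp_vec x = torus_mx e d *m y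
      & z = apt_point e (fun i => - ext_val (d 0 i))].

(* get picks an element of a nonempty set, and set0, which is not a point of
   the building, for an empty set. *)
Definition apt_retraction (T : set 'M[F]_n) (xi : set ({mpoly F[n]} -> R)) :
    set ('rV[F]_n -> R) :=
  get [set z | exists2 x, xi = berk_point x & retracts_to T x z].

Definition retraction_fiber (z : set ('rV[F]_n -> R)) : set (set ({mpoly F[n]} -> R)) :=
  [set xi | stable_locus xi /\
     forall T, max_split_torus T -> apartment T z -> apt_retraction T xi = z].

Definition retraction (xi : set ({mpoly F[n]} -> R)) : set ('rV[F]_n -> R) :=
  get [set z | building z /\ retraction_fiber z xi].

(* The element t of GL(V) sends a form f to f o t^-1 and a norm al on the dual
   of V to f |-> al (f o t). *)
Lemma apt_point_translation (e : 'M[F]_n) (d : 'rV[F]_n) (la : 'I_n -> R) :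
  is_valuation v -> 1 < q -> e \in unitmx -> (forall i, d 0 i != 0) ->
  homothety_class
    (fun f => apt_norm e la (f *m (e *m diag_mx d *m invmx e))) =
  apt_point e (fun i => la i - v (d 0 i)).
Proof.
move=> [vM _] q1 eU d0; congr homothety_class; apply/funext => f.
apply: eq_bigr => i _.
rewrite !mulmxA mulmxKV // mul_mx_diag mxE /vabs mulf_eq0 (negPf (d0 i)) orbF.
case: eqP => [_|/eqP fe0]; first by rewrite !mul0r.
have qN0 : q != 0 by rewrite gt_eqF // (lt_trans ltr01).
rewrite vM // -!powRD ?(negPf qN0) ?implybT //.
by rewrite opprD -addrA [- _ + la i]addrC.
Qed.

End Retractions.

Arguments omega {R F} v q n _.
Arguments stable_locus {R F} v q n N _.
Arguments drinfeld_retraction {R F} v q {n} xi _.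
Arguments retraction {R F} v q {n} N xi _.

(* Main.v *)
(** A point of Omega gives a norm f |-> |f(x)| on the dual of V. In a basis e
    adapted to a torus T, the T-invariant sections are multiples of powers of
    the product of the coordinates, so that the stable locus of T is the
    complement of the coordinate hyperplanes and the retraction of x to the
    apartment of T is the class of f |-> max_i |f(e_i)| |x_i|. This is the class
    of f |-> |f(x)| as soon as the apartment contains the latter, and any other
    point of the building lies with it in a common apartment, which shows that
    no other point has x in its fiber.

    Common apartments are bases orthogonal for two norms al and be. Over a
    complete discretely valued field every norm has an orthogonal basis, by
    successive best approximations; hence F, as a normed space over Q_p, is
    complete. The ratio be/al attains its maximum at a vector f of an
    al-orthogonal basis, and a be-orthogonal complement of f is then also an
    al-orthogonal one, so that one concludes by induction on the dimension. *)

Require Import Defs.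
From mathcomp Require Import all_boot all_order all_algebra all_field.
From mathcomp Require Import boolp classical_sets reals exp.
From mathcomp Require Import mpoly lra.

Set Implicit Arguments.
Unset Strict Implicit.
Unset Printing Implicit Defensive.

Import Order.TTheory GRing.Theory Num.Theory VectorInternalTheory.

Local Open Scope classical_set_scope.
Local Open Scope ring_scope.

(** * Absolute values and norms *)

Lemma le_bigmax0 (R : realType) n (F : 'I_n -> R) (c : R) :
  0 <= c -> (forall i, F i <= c) -> \big[Num.max/0]_(i < n) F i <= c.
Proof. by move=> c0 Fc; apply: bigmax_le => // i _. Qed.

Lemma bigmax0_ge0 (R : realType) n (F : 'I_n -> R) : 0 <= \big[Num.max/0]_(i < n) F i.
Proof. exact: bigmax_ge_id. Qed.

Lemma bigmax0_gt0 (R : realType) n (F : 'I_n -> R) :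
  0 < \big[Num.max/0]_(i < n) F i -> exists i, \big[Num.max/0]_(i < n) F i = F i.
Proof.
move=> m0; have /bigmax_geP[|[i _ Mi]] := lexx (\big[Num.max/0]_(i < n) F i).
  by rewrite leNgt m0.
by exists i; apply/le_anti; rewrite Mi le_bigmax.
Qed.

Lemma bigmax0Ml (R : realType) n (F : 'I_n -> R) (c : R) : 0 <= c ->
  \big[Num.max/0]_(i < n) (c * F i) = c * \big[Num.max/0]_(i < n) F i.
Proof.
move=> c0; apply: (big_ind2 (fun x y => x = c * y)) => //; first by rewrite mulr0.
by move=> _ y _ y' -> ->; rewrite maxr_pMr.
Qed.

Lemma gt1_ltr_powRr (R : realType) (q : R) : 1 < q -> {mono powR q : x y / x < y}.
Proof.
move=> q1 x y; rewrite /powR gt_eqF ?(lt_trans ltr01) //.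
by rewrite ltr_expR ltr_pM2r // ln_gt0.
Qed.

Section AbsoluteValue.

Variables (R : realType) (K : fieldType) (v : K -> R) (q : R).
Hypotheses (hv : is_valuation v) (hq : 1 < q).

Local Notation "`| x |_v" := (vabs q v x) (format "`| x |_v").

Let q0 : 0 < q. Proof. exact: lt_trans ltr01 hq. Qed.

Lemma val1 : v 1 = 0.
Proof.
have /eqP := hv.1 1 1 (oner_neq0 _) (oner_neq0 _).
by rewrite mul1r -subr_eq0 opprD addrA subrr add0r oppr_eq0 => /eqP.
Qed.

Lemma val_exp x k : x != 0 -> v (x ^+ k) = k%:R * v x.
Proof.
move=> x0; elim: k => [|k IH]; first by rewrite val1 mul0r.
by rewrite exprS hv.1 ?expf_neq0 // IH -natr1 mulrDl mul1r addrC.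
Qed.

Lemma vabs_def x : x != 0 -> `|x|_v = q `^ (- v x).
Proof. by rewrite /vabs => /negPf->. Qed.

Lemma vabs0 : `|0|_v = 0. Proof. by rewrite /vabs eqxx. Qed.

Lemma vabs_ge0 x : 0 <= `|x|_v.
Proof. by rewrite /vabs; case: ifP => // _; apply: powR_ge0. Qed.

Lemma vabs_gt0 x : (0 < `|x|_v) = (x != 0).
Proof. by rewrite /vabs; case: eqP => _; rewrite ?ltxx // powR_gt0. Qed.

Lemma vabs_eq0 x : (`|x|_v == 0) = (x == 0).
Proof. by apply/negb_inj; rewrite -vabs_gt0 lt_def vabs_ge0 andbT. Qed.

Lemma vabs1 : `|1|_v = 1.
Proof. by rewrite vabs_def ?oner_neq0 // val1 oppr0 powRr0. Qed.

Lemma vabsM x y : `|x * y|_v = `|x|_v * `|y|_v.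
Proof.
have [->|x0] := eqVneq x 0; first by rewrite mul0r vabs0 mul0r.
have [->|y0] := eqVneq y 0; first by rewrite mulr0 vabs0 mulr0.
rewrite !vabs_def ?mulf_neq0 // hv.1 // opprD powRD //.
by rewrite (gt_eqF q0) implybT.
Qed.

Lemma vabsX x k : `|x ^+ k|_v = `|x|_v ^+ k.
Proof. by elim: k => [|k IH]; rewrite ?vabs1 // !exprS vabsM IH. Qed.

Lemma vabs_prod I (s : seq I) (F : I -> K) :
  `|\prod_(i <- s) F i|_v = \prod_(i <- s) `|F i|_v.
Proof. by apply: (big_morph _ vabsM vabs1). Qed.

Lemma vabsN1 : `|-1|_v = 1.
Proof.
have : `|-1|_v ^+ 2 == 1 by rewrite -vabsX sqrrN expr1n vabs1.
by rewrite sqrf_eq1 => /orP[/eqP //|/eqP E]; have := vabs_ge0 (-1); rewrite E; lra.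
Qed.

Lemma vabsD x y : `|x + y|_v <= Num.max `|x|_v `|y|_v.
Proof.
have [->|x0] := eqVneq x 0; first by rewrite add0r le_max lexx orbT.
have [->|y0] := eqVneq y 0; first by rewrite addr0 le_max lexx.
have [->|xy0] := eqVneq (x + y) 0; first by rewrite vabs0 le_max vabs_ge0.
have := hv.2 _ _ x0 y0 xy0; rewrite !vabs_def // ge_min le_max.
by move=> /orP[] h; apply/orP; [left|right]; rewrite ler_powR ?lerN2 // ltW.
Qed.

Lemma vabs_sum_le I (s : seq I) (F : I -> K) c : 0 <= c ->
  (forall i, `|F i|_v <= c) -> `|\sum_(i <- s) F i|_v <= c.
Proof.
move=> c0 Fc; apply: (big_ind (fun x => `|x|_v <= c)) => //; first by rewrite vabs0.
by move=> x y hx hy; rewrite (le_trans (vabsD _ _)) // ge_max hx.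
Qed.

Lemma val_gtE M x : val_gt v M x <-> `|x|_v < q `^ (- M).
Proof.
rewrite /val_gt; have [->|x0] := eqVneq x 0.
  by split=> [_|]; [rewrite vabs0 powR_gt0|left].
rewrite vabs_def //; split=> [[/eqP|h]|h]; first by rewrite (negPf x0).
  by rewrite gt1_ltr_powRr // ltrN2.
by right; move: h; rewrite gt1_ltr_powRr // ltrN2.
Qed.

Lemma powR_onto (e : R) : 0 < e -> exists M : R, q `^ M = e.
Proof.
move=> e0; exists (ln e / ln q).
by rewrite /powR gt_eqF // mulfVK ?lnK ?posrE // gt_eqF // ln_gt0.
Qed.

Lemma vabs_cauchy_cvg (u : nat -> K) : val_complete v ->
  (forall e : R, 0 < e -> exists k0, forall k l,
     (k0 <= k)%N -> (k0 <= l)%N -> `|u k - u l|_v < e) ->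
  exists x, forall e : R, 0 < e -> exists k0, forall k,
     (k0 <= k)%N -> `|u k - x|_v < e.
Proof.
move=> vc uC; have [|x xP] := vc u.
  move=> M; have [k0 h] := uC (q `^ (- M)) (powR_gt0 _ q0).
  by exists k0 => k l hk hl; apply/val_gtE/h.
exists x => e e0; have [M ME] := powR_onto e0.
have [k0 h] := xP (- M); exists k0 => k hk.
by have /val_gtE := h k hk; rewrite opprK ME.
Qed.

End AbsoluteValue.

(** * Norms and orthogonal families of linear forms *)

Section Norms.

Variables (R : realType) (K : fieldType) (v : K -> R) (q : R).
Hypotheses (hv : is_valuation v) (hq : 1 < q).
Variables (n : nat) (al : 'rV[K]_n -> R).
Hypothesis hal : is_norm v q al.

Local Notation "`| x |_v" := (vabs q v x) (format "`| x |_v").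

Lemma norm_ge0 f : 0 <= al f. Proof. by case: hal. Qed.

Lemma norm_eq0 f : (al f == 0) = (f == 0).
Proof. by case: hal => _ h _ _; apply/eqP/eqP => /h. Qed.

Lemma norm0 : al 0 = 0. Proof. by apply/eqP; rewrite norm_eq0. Qed.

Lemma norm_gt0 f : (0 < al f) = (f != 0).
Proof. by rewrite lt_def norm_ge0 norm_eq0 andbT. Qed.

Lemma normZ a f : al (a *: f) = `|a|_v * al f. Proof. by case: hal. Qed.

Lemma normN f : al (- f) = al f.
Proof. by rewrite -scaleN1r normZ vabsN1 // mul1r. Qed.

Lemma normD f g : al (f + g) <= Num.max (al f) (al g). Proof. by case: hal. Qed.

Lemma normB f g : al (f - g) <= Num.max (al f) (al g).
Proof. by rewrite -(normN g) normD. Qed.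

Lemma normD_lt f g c : al f < c -> al g < c -> al (f + g) < c.
Proof. by move=> hf hg; rewrite (le_lt_trans (normD _ _)) // gt_max hf. Qed.

(** The isosceles triangle principle: [g = (f + g) - f], and [al f] is too small to bound [al g]. *)
Lemma normD_eq f g : al f < al g -> al (f + g) = al g.
Proof.
move=> fg; apply/le_anti; rewrite (le_trans (normD _ _)) ?ge_max ?(ltW fg) //=.
have := normB (f + g) f; rewrite [X in X - f]addrC addrK => h.
by move: h; rewrite le_max => /orP[//|]; rewrite leNgt fg.
Qed.

Lemma norm_sum_le I (s : seq I) (F : I -> 'rV_n) c : 0 <= c ->
  (forall i, al (F i) <= c) -> al (\sum_(i <- s) F i) <= c.
Proof.
move=> c0 Fc; apply: (big_ind (fun x => al x <= c)) => //; first by rewrite norm0.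
by move=> x y hx hy; rewrite (le_trans (normD _ _)) // ge_max hx.
Qed.

(** Only the lower bound is required, since the ultrametric inequality gives the converse. Zero rows
    are allowed, hence the separate condition [row i B != 0] below. *)
Definition orthogonal_rows m (B : 'M[K]_(m, n)) : Prop :=
  forall (c : 'rV[K]_m) (i : 'I_m), `|c 0 i|_v * al (row i B) <= al (c *m B).

Lemma orthogonal_normE m (B : 'M[K]_(m, n)) : orthogonal_rows B ->
  forall c, al (c *m B) = \big[Num.max/0]_(i < m) (`|c 0 i|_v * al (row i B)).
Proof.
move=> oB c; apply/le_anti/andP; split; last first.
  by apply: le_bigmax0 => [|i]; [exact: norm_ge0 | exact: oB].
rewrite mulmx_sum_row; apply: norm_sum_le => [|i]; first exact: bigmax0_ge0.
by rewrite normZ le_bigmax.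
Qed.

(** Completeness of the row space of [B], phrased on coefficient vectors so that limits stay in that
    space. *)
Definition complete_on m (B : 'M[K]_(m, n)) : Prop :=
  forall c : nat -> 'rV[K]_m,
    (forall e : R, 0 < e -> exists k0, forall k l,
       (k0 <= k)%N -> (k0 <= l)%N -> al ((c k - c l) *m B) < e) ->
    exists c', forall e : R, 0 < e -> exists k0, forall k,
       (k0 <= k)%N -> al ((c k - c') *m B) < e.

(** Orthogonality bounds each coordinate by the norm, so coordinates converge separately; the norm
    is their weighted maximum, so convergence passes back. *)
Lemma orthogonal_complete m (B : 'M[K]_(m, n)) : val_complete v ->
  orthogonal_rows B -> (forall i, row i B != 0) -> complete_on B.
Proof.
move=> vc oB B0 c cC.
have /choice[x xP] : forall i, exists x, forall e : R, 0 < e ->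
    exists k0, forall k, (k0 <= k)%N -> `|c k 0 i - x|_v < e.
  move=> i; apply: (vabs_cauchy_cvg hq vc) => e e0.
  have a0 : 0 < al (row i B) by rewrite norm_gt0.
  have [k0 h] := cC _ (mulr_gt0 e0 a0); exists k0 => k l hk hl.
  rewrite -(ltr_pM2r a0) (le_lt_trans _ (h k l hk hl)) //.
  by have := oB (c k - c l) i; rewrite !mxE.
exists (\row_i x i) => e e0.
have /choice[k0 h] : forall i, exists k0, forall k, (k0 <= k)%N ->
    `|c k 0 i - x i|_v * al (row i B) < e.
  move=> i; have a0 : 0 < al (row i B) by rewrite norm_gt0.
  have [k0 h] := xP i _ (divr_gt0 e0 a0); exists k0 => k /h.
  by rewrite ltr_pdivlMr.
exists (\max_i k0 i) => k hk; rewrite orthogonal_normE //; apply: bigmax_lt => // i _.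
by rewrite !mxE; apply: h; rewrite (leq_trans _ hk) // leq_bigmax.
Qed.

(* Among [m + 1] consecutive values two come from the same row of [B], so their
   ratio is an integral power of [q]. *)
Lemma orthogonal_gap m (B : 'M[K]_(m, n)) (d : nat -> R) :
  (forall x, x != 0 -> exists k : int, v x = k%:~R) ->
  orthogonal_rows B ->
  (forall k, exists2 c, d k = al (c *m B) & c *m B != 0) ->
  (forall k, d k.+1 < d k) ->
  forall k, d (k + m)%N <= d k / q.
Proof.
move=> vZ oB dB dlt k.
have q0 : 0 < q by rewrite (lt_trans ltr01).
have dP j : exists im : 'I_m * int,
    d j = q `^ (- im.2%:~R) * al (row im.1 B) /\ 0 < al (row im.1 B).
  have [c dc c0] := dB j.
  have dj0 : 0 < d j by rewrite dc norm_gt0.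
  move: dc; rewrite orthogonal_normE // => dc; rewrite dc in dj0.
  have [i iE] := bigmax0_gt0 dj0; rewrite iE in dc dj0.
  have ci0 : c 0 i != 0.
    by apply: contraTneq dj0 => ->; rewrite vabs0 mul0r ltxx.
  have [z zE] := vZ _ ci0; exists (i, z); rewrite -zE dc vabs_def //; split=> //.
  by move: dj0; rewrite pmulr_rgt0 // vabs_gt0.
have /choice[im imP] := dP.
have dmono i j : (i < j)%N -> d j < d i.
  elim: j => // j IH; rewrite ltnS leq_eqVlt => /orP[/eqP->//|/IH].
  exact: lt_trans.
have dle i j : (i <= j)%N -> d j <= d i.
  by rewrite leq_eqVlt => /orP[/eqP->//|/dmono/ltW].
have : ~~ injectiveb (fun j : 'I_m.+1 => (im (k + j)%N).1).
  by apply/negP => /injectiveP/leq_card; rewrite !card_ord ltnn.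
move=> /injectivePn[i1 [i2 ne12 e12]].
wlog lt12 : i1 i2 ne12 e12 / (i1 < i2)%N.
  move=> W; have [] := ltngtP i1 i2; first exact: W.
    by move=> lt21; apply: (W i2 i1); rewrite 1?eq_sym.
  by move=> /val_inj e; rewrite e eqxx in ne12.
apply: (@le_trans _ _ (d (k + i2)%N)); first by rewrite dle // leq_add2l -ltnS.
apply: (@le_trans _ _ (d (k + i1)%N / q)); last first.
  by rewrite ler_pM2r ?invr_gt0 // dle // leq_addr.
have : d (k + i2)%N < d (k + i1)%N by rewrite dmono // ltn_add2l.
have [-> a0] := imP (k + i1)%N; have [-> _] := imP (k + i2)%N.
(* For a common row, distinct integral exponents differ by at least 1, whence the factor [q]. *)
rewrite /= in e12; rewrite -e12 ltr_pM2r // gt1_ltr_powRr // ltrN2 ltr_int.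
rewrite -lezD1 => lez.
rewrite mulrAC ler_pM2r // -[X in _ / X]powRr1 ?(ltW q0) //.
rewrite -powRN -powRD; last by rewrite (gt_eqF q0) implybT.
by rewrite ler_powR ?(ltW hq) // -opprD lerN2 -[1]/(1%:~R) -intrD ler_int.
Qed.

End Norms.

Lemma exp_small (R : realType) (q c e : R) : 1 < q -> 0 < e ->
  exists j : nat, c / q ^+ j < e.
Proof.
move=> q1 e0; have q0 : 0 < q := lt_trans ltr01 q1.
have [c0|c0] := leP c 0.
  by exists 0%N; rewrite expr0 divr1 (le_lt_trans c0).
have [M ME] := powR_onto q1 (divr_gt0 c0 e0).
have [j jM] : exists j : nat, M < j%:R.
  exists (Num.Def.archi_bound `|M|).
  by rewrite (le_lt_trans (ler_norm M)) // archi_boundP.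
exists j; rewrite ltr_pdivrMr ?exprn_gt0 // mulrC -ltr_pdivrMr //.
by rewrite -ME -powR_mulrn ?(ltW q0) // gt1_ltr_powRr.
Qed.

(** * Best approximation and orthogonal bases *)

Section Orthogonalization.

Variables (R : realType) (K : fieldType) (v : K -> R) (q : R).
Hypotheses (hv : is_valuation v) (hq : 1 < q).
Variables (n : nat) (al : 'rV[K]_n -> R).
Hypothesis hal : is_norm v q al.

Local Notation "`| x |_v" := (vabs q v x) (format "`| x |_v").

(** The bound makes [g] orthogonal to the rows of [B]: as the difference of [a *: g + c *m B] and
    [a *: g], the part [c *m B] is also bounded by the norm of the sum. *)
Lemma orthogonal_col_mx m (g : 'rV[K]_n) (B : 'M[K]_(m, n)) :
  orthogonal_rows v q al B ->
  (forall a (c : 'rV_m), `|a|_v * al g <= al (a *: g + c *m B)) ->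
  orthogonal_rows v q al (col_mx g B).
Proof.
move=> oB bound c j; rewrite -[c]hsubmxK mul_row_col.
set c1 := lsubmx _; set c2 := rsubmx _.
rewrite [c1]mx11_scalar mul_scalar_mx; set a := c1 0 0.
case: (split_ordP j) => k ->.
  by rewrite row_mxEl rowKu row_id ord1 mxE eqxx mulr1n.
rewrite row_mxEr rowKd (le_trans (oB c2 k)) //.
have E : c2 *m B = (a *: g + c2 *m B) - a *: g by rewrite addrAC subrr add0r.
rewrite {1}E (le_trans (normB hv hq hal _ _)) // ge_max lexx (normZ hal).
exact: bound.
Qed.

Lemma orthogonal_unitmx (B : 'M[K]_n) :
  orthogonal_rows v q al B -> (forall i, row i B != 0) -> B \in unitmx.
Proof.
move=> oB B0; rewrite -row_free_unit; apply: inj_row_free => c cB.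
apply/rowP => i; rewrite mxE; apply/eqP; rewrite -(vabs_eq0 v hq).
have := oB c i; rewrite cB (norm0 hal).
by rewrite pmulr_lle0 ?(norm_gt0 hal) // => h; rewrite eq_le h vabs_ge0.
Qed.

Hypothesis vZ : forall x, x != 0 -> exists k : int, v x = k%:~R.
Hypothesis vc : val_complete v.

(** Otherwise approximations improve forever. Consecutive differences lie in the row space and have
    the norm of the larger error, so the errors drop by a factor [q] every [m] steps. The sequence
    is then Cauchy, and its limit puts [f] in the row space. *)
Lemma best_approximation m (B : 'M[K]_(m, n)) (f : 'rV[K]_n) :
  orthogonal_rows v q al B -> (forall i, row i B != 0) -> ~~ (f <= B)%MS ->
  exists c0, forall c, al (f - c0 *m B) <= al (f - c *m B).
Proof.
move=> oB B0 fB; apply: contrapT => nomin.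
have /choice[g gP] : forall c, exists c', al (f - c' *m B) < al (f - c *m B).
  move=> c; apply: contrapT => h; apply: nomin; exists c => c'.
  by rewrite leNgt; apply/negP => h'; apply: h; exists c'.
pose c k := iter k g 0; pose d k := al (f - c k *m B).
have dlt k : d k.+1 < d k by apply: gP.
have q0 : 0 < q := lt_trans ltr01 hq.
have dle i j : (i <= j)%N -> d j <= d i.
  elim: j => [|j IH]; first by rewrite leqn0 => /eqP->.
  rewrite leq_eqVlt => /orP[/eqP->//|/IH]; apply: le_trans.
  exact: ltW.
have ccE i j : (c i - c j) *m B = (f - c j *m B) - (f - c i *m B).
  by rewrite mulmxBl opprB [RHS]addrC addrA subrK.
have gap : forall k, d (k + m)%N <= d k / q.
  apply: (orthogonal_gap hq hal vZ oB) => // k; exists (c k - c k.+1).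
    by rewrite ccE (normD_eq hv hq hal) (normN hv hq hal) ?dlt //; apply: dlt.
  apply/eqP => E; have := dlt k.
  have -> : d k.+1 = d k; last by rewrite ltxx.
  congr al; apply/eqP; rewrite -subr_eq0 -ccE.
  by rewrite E.
have dsmall e : 0 < e -> exists k, d k < e.
  move=> e0; have [j jP] := exp_small (d 0) hq e0; exists (j * m)%N.
  apply: le_lt_trans jP; elim: j => [|j IH]; first by rewrite divr1.
  rewrite mulSn addnC (le_trans (gap _)) // exprSr invfM mulrA.
  by rewrite ler_pM2r ?invr_gt0.
have [|c' c'P] := orthogonal_complete hq hal vc oB B0 (c := c).
  move=> e /dsmall[k0 k0P]; exists k0 => k l hk hl; rewrite ccE.
  rewrite (le_lt_trans (normB hv hq hal _ _)) // gt_max.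
  by rewrite !(le_lt_trans _ k0P) // dle.
suff /eqP : al (f - c' *m B) = 0.
  by rewrite (norm_eq0 hal) subr_eq0 => /eqP fE; rewrite fE submxMl in fB.
apply/eqP/negPn/negP => ne0.
have {ne0} e0 : 0 < al (f - c' *m B) by rewrite lt_def ne0 (norm_ge0 hal).
(* For large [k], both [f - c k *m B] and [(c k - c') *m B] are smaller than this distance, which is
   the norm of their sum. *)
have [k1 h1] := dsmall _ e0; have [k2 h2] := c'P _ e0.
have := h2 _ (leq_maxr k1 k2); have := le_lt_trans (dle _ _ (leq_maxl k1 k2)) h1.
move=> a b; have := normD_lt hal a b.
by rewrite mulmxBl addrA subrK ltxx.
Qed.

(** Gram-Schmidt, with the error [g] of a best approximation as new vector: for [a != 0],
    [a *: g + c *m B] is [a] times another approximation error of [f], hence not smaller than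
    [a *: g]. *)
Lemma orthogonal_family m : (m <= n)%N ->
  exists2 B : 'M[K]_(m, n), orthogonal_rows v q al B & forall i, row i B != 0.
Proof.
elim: m => [|m IH] mn; first by exists 0 => [c|] [].
have [B oB B0] := IH (ltnW mn).
have [i fB] : exists i, ~~ (row i (1%:M : 'M[K]_n) <= B)%MS.
  apply/existsP; rewrite -negb_forall; apply: contraL mn => /forallP h.
  rewrite -ltnNge ltnS -{1}(mxrank1 K n) (leq_trans _ (rank_leq_row B)) //.
  by apply/mxrankS/row_subP => i; apply: h.
set f := row i _ in fB; have [c0 c0P] := best_approximation oB B0 fB.
pose g := f - c0 *m B; have g0 : g != 0.
  by apply: contra fB; rewrite subr_eq0 => /eqP->; apply: submxMl.
suff [A oA A0] : exists2 A : 'M[K]_(1 + m, n),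
    orthogonal_rows v q al A & forall i, row i A != 0 by exists A.
exists (col_mx g B); last first.
  move=> j; case: (split_ordP j) => k ->.
    by rewrite rowKu row_id.
  by rewrite rowKd.
apply: orthogonal_col_mx => // a c.
have [->|a0] := eqVneq a 0; first by rewrite vabs0 mul0r (norm_ge0 hal).
have -> : a *: g + c *m B = a *: (f - (c0 - a^-1 *: c) *m B).
  rewrite mulmxBl opprB addrA addrAC [RHS]scalerDr -scalemxAl scalerA divff //.
  by rewrite scale1r.
by rewrite (normZ hal) ler_wpM2l ?vabs_ge0.
Qed.

Lemma orthogonal_basis : exists2 B : 'M[K]_n, orthogonal_rows v q al B & B \in unitmx.
Proof.
have [B oB B0] := orthogonal_family (leqnn n).
by exists B => //; apply: orthogonal_unitmx.
Qed.

End Orthogonalization.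

Lemma row_unitmx_neq0 (K : fieldType) n (B : 'M[K]_n) i : B \in unitmx -> row i B != 0.
Proof.
move=> uB; apply/eqP => /(congr1 (mulmx^~ (invmx B))).
rewrite mul0mx -row_mul mulmxV // => /rowP/(_ i); rewrite !mxE eqxx => /eqP.
by rewrite oner_eq0.
Qed.

(** The absolute value of [F] is a norm on a finite-dimensional space over the complete field [Qp];
    in an orthogonal basis, convergence in [F] is coordinatewise. *)
Lemma normalized_extension_complete (R : realType) (q : R) (Qp : fieldType)
    (vp : Qp -> R) (F : fieldExtType Qp) (v : F -> R) : 1 < q ->
  is_valuation vp -> val_complete vp -> is_normalized_extension vp v ->
  val_complete v.
Proof.
move=> q1 [vpM vpD] vpc [hv vZ _ [e e0 ve]].
(* The factor [e] makes [w] the restriction of [v] to [Qp], hence integer-valued. *)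
pose w a : R := e%:R * vp a.
have e1 : 0 < e%:R :> R by rewrite ltr0n.
have hw : is_valuation w.
  split=> x y x0 y0; first by rewrite /w vpM // mulrDr.
  by move=> xy; rewrite /w -minr_pMr ?(ltW e1) // ler_wpM2l ?(ltW e1) ?vpD.
have alg0 (a : Qp) : (a%:A == 0 :> F) = (a == 0).
  by rewrite scaler_eq0 oner_eq0 orbF.
have wZ a : a != 0 -> exists k : int, w a = k%:~R.
  by move=> a0; rewrite /w -ve //; apply: vZ; rewrite alg0.
have wgt M a : val_gt w M a <-> val_gt vp (M / e%:R) a.
  by rewrite /val_gt /w ltr_pdivrMr // mulrC.
have wc : val_complete w.
  move=> u uC; have [M|x xP] := vpc u.
    have [k0 h] := uC (M * e%:R); exists k0 => k l hk hl.
    by have /wgt := h k l hk hl; rewrite mulfK // gt_eqF.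
  by exists x => M; have [k0 h] := xP (M / e%:R); exists k0 => k /h /wgt.
pose al (u : 'rV[Qp]_(dim F)) := vabs q v (r2v u).
have hal : is_norm w q al.
  split=> [f|f|a f|f g]; rewrite /al.
  - exact: vabs_ge0.
  - split=> [/eqP|->]; last by rewrite linear0 vabs0.
    by rewrite vabs_eq0 // => /eqP E; apply: (can_inj r2vK); rewrite E linear0.
  - rewrite linearZ /= -mulr_algl vabsM //; congr (_ * _).
    by rewrite /vabs alg0; case: eqP => // /eqP a0; rewrite ve.
  - by rewrite linearD vabsD.
have [B oB uB] := orthogonal_basis hw q1 hal wZ wc.
have B0 i := row_unitmx_neq0 i uB.
move=> u uC; pose c k := v2r (u k) *m invmx B.
have cE k x : al ((c k - x) *m B) = vabs q v (u k - r2v (x *m B)).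
  by rewrite /al mulmxBl mulmxKV // linearB /= v2rK.
have [|x xP] := orthogonal_complete q1 hal wc oB B0 (c := c).
  move=> d d0; have [M Md] := powR_onto q1 d0; have [k0 h] := uC (- M).
  exists k0 => k l hk hl; rewrite cE mulmxKV // v2rK -Md -[M]opprK.
  exact/val_gtE/h.
exists (r2v (x *m B)) => M; have [k0 h] := xP _ (powR_gt0 (- M) (lt_trans ltr01 q1)).
by exists k0 => k /h; rewrite cE => /val_gtE; apply.
Qed.

(** * Bases orthogonal for two norms *)

Section TwoNorms.

Variables (R : realType) (K : fieldType) (v : K -> R) (q : R).
Hypotheses (hv : is_valuation v) (hq : 1 < q).
Hypothesis vZ : forall x, x != 0 -> exists k : int, v x = k%:~R.
Hypothesis vc : val_complete v.

Local Notation "`| x |_v" := (vabs q v x) (format "`| x |_v").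

(** In an [al]-orthogonal basis [al] equals the maximum of the terms and [be] is at most their
    maximum, so the best ratio among basis vectors is the best overall. Cross-multiplication covers
    [g = 0]. *)
Lemma norm_ratio_max n (al be : 'rV[K]_n.+1 -> R) :
  is_norm v q al -> is_norm v q be ->
  exists2 f, f != 0 & forall g, be g * al f <= be f * al g.
Proof.
move=> hal hbe; have [A oA uA] := orthogonal_basis hv hq hal vZ vc.
have A0 i := row_unitmx_neq0 i uA.
have al0 i : 0 < al (row i A) by rewrite (norm_gt0 hal).
have be0 i : 0 < be (row i A) by rewrite (norm_gt0 hbe).
pose r i := be (row i A) / al (row i A).
have [|i iM] := @bigmax0_gt0 _ _ r.
  by rewrite (lt_le_trans _ (le_bigmax _ r 0)) // divr_gt0.
have rM j : be (row j A) * al (row i A) <= be (row i A) * al (row j A).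
  have : r j <= r i by rewrite -iM le_bigmax.
  by rewrite /r ler_pdivrMr // mulrAC ler_pdivlMr.
exists (row i A) => // g; rewrite -(mulmxKV uA g); move: (g *m _) => c {g}.
rewrite -ler_pdivlMr // {1}mulmx_sum_row.
apply: (norm_sum_le hbe) => [|j].
  by rewrite divr_ge0 ?mulr_ge0 ?(norm_ge0 hal) ?(norm_ge0 hbe).
rewrite (normZ hbe) ler_pdivlMr // -mulrA.
apply: (@le_trans _ _ (`|c 0 j|_v * (be (row i A) * al (row j A)))).
  by rewrite ler_wpM2l ?vabs_ge0.
by rewrite mulrCA ler_wpM2l ?(norm_ge0 hbe) //; apply: oA.
Qed.

Lemma common_orthogonal_rows n (al be : 'rV[K]_n -> R) :
  is_norm v q al -> is_norm v q be ->
  exists B : 'M[K]_n, [/\ orthogonal_rows v q al B, orthogonal_rows v q be B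
    & forall i, row i B != 0].
Proof.
elim: n => [|n IH] in al be *; first by exists 0; split=> [c|c|] [].
move=> hal hbe; have [f f0 fmax] := norm_ratio_max hal hbe.
have [G oG uG] := orthogonal_basis hv hq hbe vZ vc.
have al_f : 0 < al f by rewrite (norm_gt0 hal).
have be_f : 0 < be f by rewrite (norm_gt0 hbe).
pose d := f *m invmx G; have fE : f = d *m G by rewrite mulmxKV.
have [|j jE] := @bigmax0_gt0 _ _ (fun i => `|d 0 i|_v * be (row i G)).
  by rewrite -(orthogonal_normE hbe oG) -fE.
rewrite -(orthogonal_normE hbe oG) -fE in jE.
(* [H] consists of the rows of [G] other than the [j]-th, where the [j]-th term of [f] attains
   [be f]. *)
pose E : 'M[K]_(n, n.+1) := row' j 1%:M; pose H := E *m G.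
have cE (c : 'rV_n) i : (c *m E) 0 (lift j i) = c 0 i.
  rewrite mxE (bigD1 i) //= !mxE eqxx mulr1 big1 ?addr0 // => k ki.
  by rewrite !mxE (inj_eq lift_inj) (negPf ki) mulr0.
have cE0 (c : 'rV_n) : (c *m E) 0 j = 0.
  by rewrite mxE big1 // => k _; rewrite !mxE eq_sym (negPf (neq_lift _ _)) mulr0.
have restr ga : is_norm v q ga -> is_norm v q (fun c : 'rV_n => ga (c *m H)).
  move=> hga; split=> [c|c|a c|c c'].
  - exact: (norm_ge0 hga).
  - split=> [/eqP|->]; last by rewrite mul0mx (norm0 hga).
    rewrite (norm_eq0 hga) mulmxA => /eqP/(congr1 (mulmx^~ (invmx G))).
    by rewrite mulmxK // mul0mx => c0; apply/rowP => i; rewrite -cE c0 !mxE.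
  - by rewrite -scalemxAl (normZ hga).
  - by rewrite mulmxDl (normD hga).
have [B [oBa oBb B0]] := IH _ _ (restr _ hal) (restr _ hbe).
(* The [j]-th coordinate of the sum comes from [a *: f] alone and already has the required size. *)
have boundb a (c : 'rV_n) : `|a|_v * be f <= be (a *: f + c *m H).
  have -> : a *: f + c *m H = (a *: d + c *m E) *m G.
    by rewrite mulmxDl -scalemxAl -fE mulmxA.
  have := oG (a *: d + c *m E) j.
  by rewrite mxE cE0 addr0 mxE vabsM // -mulrA -jE.
(* After multiplication by [be f], this follows from [boundb] and the maximality of the ratio at
   [f]. *)
have bounda a (c : 'rV_n) : `|a|_v * al f <= al (a *: f + c *m H).
  rewrite -(ler_pM2l be_f) (le_trans _ (fmax _)) // mulrCA mulrA ler_pM2r //.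
have orthH ga : orthogonal_rows v q (fun c => ga (c *m H)) B ->
    orthogonal_rows v q ga (B *m H).
  by move=> oB c i; rewrite row_mul mulmxA; apply: oB.
suff [A [oAa oAb A0]] : exists A : 'M[K]_(1 + n, n.+1),
  [/\ orthogonal_rows v q al A, orthogonal_rows v q be A
    & forall i, row i A != 0] by exists A.
exists (col_mx f (B *m H)); split.
- apply: (orthogonal_col_mx hv hq hal) => [|a c]; first exact: orthH.
  by rewrite mulmxA.
- apply: (orthogonal_col_mx hv hq hbe) => [|a c]; first exact: orthH.
  by rewrite mulmxA.
move=> i; case: (split_ordP i) => k ->; first by rewrite rowKu row_id.
by rewrite rowKd row_mul -(norm_eq0 hal) (norm_eq0 (restr _ hal)).
Qed.

(** The basis [e] is dual to the orthogonal forms [B], and the weights are the logarithms to base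
    [q] of the norms of these forms. *)
Lemma common_apartment n (al be : 'rV[K]_n -> R) :
  is_norm v q al -> is_norm v q be ->
  exists (e : 'M[K]_n) la mu, [/\ e \in unitmx, al = apt_norm v q e la
    & be = apt_norm v q e mu].
Proof.
move=> hal hbe; have [B [oBa oBb B0]] := common_orthogonal_rows hal hbe.
have uB := orthogonal_unitmx hq hal oBa B0.
have apt ga : is_norm v q ga -> orthogonal_rows v q ga B ->
    exists la, ga = apt_norm v q (invmx B) la.
  move=> hga oB; have /choice[la laP] : forall i, exists l, q `^ l = ga (row i B).
    by move=> i; apply: powR_onto; rewrite ?(norm_gt0 hga).
  exists la; apply/funext => f; rewrite -{1}(mulmxKV uB f) (orthogonal_normE hga oB).
  by apply: eq_bigr => i _; rewrite laP.
have [la laE] := apt _ hal oBa; have [mu muE] := apt _ hbe oBb.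
by exists (invmx B), la, mu; rewrite unitmx_inv.
Qed.

End TwoNorms.

(** * Tori and invariant sections *)

Section Tori.

Variables (R : realType) (F : fieldType) (v : F -> R) (pi : F).
Hypotheses (hv : is_valuation v) (pi0 : pi != 0) (vpi : v pi = 1).
Variable n : nat.
Implicit Types (e t : 'M[F]_n) (d : 'rV[F]_n) (T : set 'M[F]_n).

(** The powers of [pi] supply distinct scalars for regular elements and for polynomial
    identities. *)
Lemma uniformizer_exp_inj : injective (fun k => pi ^+ k).
Proof.
move=> k l /(congr1 v); rewrite !(val_exp hv) // vpi !mulr1 => /eqP.
by rewrite eqr_nat => /eqP.
Qed.

Definition diag_torus e : set 'M[F]_n :=
  [set t | t \in unitmx /\ is_diag_mx (invmx e *m t *m e)].

Lemma diag_mx_unit d : (diag_mx d \in unitmx) = [forall i, d 0 i != 0].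
Proof.
rewrite unitmxE det_diag unitfE; by apply/prodf_neq0/forallP => h i *; apply: h.
Qed.

Lemma diag_torusP e t : e \in unitmx ->
  diag_torus e t <->
  exists2 d : 'rV_n, forall i, d 0 i != 0 & t = e *m diag_mx d *m invmx e.
Proof.
move=> uE; split=> [[ut /diag_mxP[d dE]]|[d d0 ->]].
  exists d; last by rewrite -dE !mulmxA mulmxV // mul1mx mulmxK.
  by apply/forallP; rewrite -diag_mx_unit -dE !unitmx_mul unitmx_inv uE ut.
split; last by rewrite !mulmxA mulVmx // mul1mx mulmxKV // diag_mx_is_diag.
by rewrite !unitmx_mul unitmx_inv uE diag_mx_unit /= andbT; apply/forallP.
Qed.

Lemma diag_torus_split e : e \in unitmx -> split_group (diag_torus e).
Proof.
move=> uE; split=> [t []//||t u [ut dt] [uu du]|t [ut dt]|].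
- by split; rewrite ?unitmx1 // mulmx1 mulVmx // scalar_mx_is_diag.
- split; first by rewrite unitmx_mul ut.
  have -> : invmx e *m (t *m u) *m e = (invmx e *m t *m e) *m (invmx e *m u *m e).
    by rewrite !mulmxA mulmxK.
  move/diag_mxP: dt => [a ->]; move/diag_mxP: du => [b ->].
  apply/is_diag_mxP => i j ij; rewrite mul_diag_mx !mxE.
  by rewrite (negPf (_ : i != j)) // mulr0n mulr0.
- split; first by rewrite unitmx_inv.
  have ud : invmx e *m t *m e \in unitmx by rewrite !unitmx_mul unitmx_inv uE ut.
  have iE : (invmx e *m invmx t *m e) *m (invmx e *m t *m e) = 1%:M.
    by rewrite !mulmxA mulmxK // mulmxKV // mulVmx.
  have := iE; move/diag_mxP: dt => [a aE]; rewrite aE => aV.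
  rewrite aE diag_mx_unit in ud; move/forallP: ud => a0.
  apply/is_diag_mxP => i j ij; have := congr1 (fun M : 'M_n => M i j) aV.
  rewrite mul_mx_diag !mxE (negPf (_ : i != j)) // => /eqP.
  by rewrite mulf_eq0 (negPf (a0 j)) orbF => /eqP.
- by exists e; split=> // t [].
Qed.

(** With distinct entries, only diagonal matrices commute with [diag_mx regular]. *)
Let regular : 'rV[F]_n := \row_i pi ^+ i.

Let regular_neq0 i : regular 0 i != 0.
Proof. by rewrite mxE expf_neq0. Qed.

Let regular_inj : injective (regular 0).
Proof. by move=> i j; rewrite !mxE => /uniformizer_exp_inj/val_inj. Qed.

(** A larger split group is commutative and contains a regular element; whatever commutes with the
    latter is diagonal in the basis [e]. *)
Lemma diag_torus_max e : e \in unitmx -> max_split_torus (diag_torus e).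
Proof.
move=> uE; split=> [|T [Tunit _ _ _ [e' [uE' dT]]] sT t Tt].
  exact: diag_torus_split.
split; first exact: Tunit.
pose r := e *m diag_mx regular *m invmx e.
have Tr : T r by apply: sT; apply/diag_torusP => //; exists regular.
have comm : r *m t = t *m r.
  have /diag_mxP[a aE] := dT _ Tr; have /diag_mxP[b bE] := dT _ Tt.
  have -> : r = e' *m diag_mx a *m invmx e'.
    by rewrite -aE !mulmxA mulmxV // mul1mx mulmxK.
  have -> : t = e' *m diag_mx b *m invmx e'.
    by rewrite -bE !mulmxA mulmxV // mul1mx mulmxK.
  by rewrite !mulmxA !mulmxKV // -!(mulmxA e') diag_mxC.
have : diag_mx regular *m (invmx e *m t *m e) = (invmx e *m t *m e) *m diag_mx regular.
  have := congr1 (fun X => invmx e *m X *m e) comm.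
  by rewrite /r !mulmxA mulVmx // mul1mx mulmxKV.
move=> /matrixP rE; apply/is_diag_mxP => i j ij; apply/eqP.
have /eqP := rE i j; rewrite mul_diag_mx mul_mx_diag !mxE mulrC -subr_eq0 -mulrBr.
rewrite mulf_eq0 subr_eq0 => /orP[//|/eqP/uniformizer_exp_inj ij'].
by rewrite ij' eqxx in ij.
Qed.

Lemma max_split_torus_full T e d : max_split_torus T -> diagonalizes e T ->
  (forall i, d 0 i != 0) -> T (e *m diag_mx d *m invmx e).
Proof.
move=> [[Tunit _ _ _ _] Tmax] [uE dT] d0.
apply: (Tmax (diag_torus e)); first exact: diag_torus_split.
  by move=> t Tt; split; [apply: Tunit | apply: dT].
by apply/diag_torusP => //; exists d.
Qed.

(* The product is [f] applied to the projection of [x] to a common eigenline of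
   [T], so it depends on the basis only through the numbering of these lines. *)
Lemma eigenline_term T e e' (K : fieldType) (h : {rmorphism F -> K})
    (x : 'cV[K]_n) (j : 'I_n) :
  max_split_torus T -> diagonalizes e T -> diagonalizes e' T ->
  exists i, forall f : 'rV[F]_n,
    h ((f *m e) 0 j) * (invmx (map_mx h e) *m x) j 0 =
    h ((f *m e') 0 i) * (invmx (map_mx h e') *m x) i 0.
Proof.
move=> Tmax dT [uE' dT']; have [uE dTe] := dT.
(* An element regular in the basis [e'] is also diagonal in [e], so the base changes [M] and [N]
   intertwine two diagonal matrices. *)
have Tr := max_split_torus_full Tmax (conj uE' dT') regular_neq0.
have /diag_mxP[c cE] := dTe _ Tr.
pose M := invmx e' *m e; pose N := invmx e *m e'.
have NM : N *m M = 1%:M by rewrite !mulmxA mulmxK // mulVmx.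
have rM : diag_mx regular *m M = M *m diag_mx c.
  by rewrite -cE !mulmxA mulmxK // mulVmx // mul1mx.
have rN : N *m diag_mx regular = diag_mx c *m N.
  by rewrite -cE !mulmxA mulmxK // mulmxKV.
have eM : e = e' *m M by rewrite mulKVmx.
have xN : invmx (map_mx h e) *m x = map_mx h N *m (invmx (map_mx h e') *m x).
  rewrite -!map_invmx map_mxM !mulmxA -[_ *m map_mx h e' *m _]mulmxA -map_mxM.
  by rewrite mulmxV // map_mx1 mulmx1.
clearbody M N; have [i Mij] : exists i, M i j != 0.
  apply/existsP; rewrite -negb_forall; apply/negP => /forallP M0.
  have /matrixP/(_ j j)/eqP := NM; rewrite !mxE eqxx big1 ?(eq_sym 0) ?oner_eq0 //.
  by move=> k _; rewrite (eqP (M0 k)) mulr0.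
(* As the eigenvalues are distinct, [M i j] is the only nonzero entry of its column and [N j i] of
   its row; their product is 1, so the two changes of coordinates cancel. *)
have ci : c 0 j = regular 0 i.
  have /matrixP/(_ i j)/eqP := rM; rewrite mul_diag_mx mul_mx_diag !mxE mulrC.
  by move=> /eqP/(mulfI Mij).
have M0 k : k != i -> M k j = 0.
  move=> ki; have /matrixP/(_ k j) := rM.
  rewrite mul_diag_mx mul_mx_diag !mxE ci !mxE [RHS]mulrC => /eqP.
  rewrite -subr_eq0 -mulrBl.
  rewrite mulf_eq0 subr_eq0 => /orP[|/eqP//].
  by have := ki; rewrite -(inj_eq regular_inj) !mxE => /negPf->.
have N0 k : k != i -> N j k = 0.
  move=> ki; have /matrixP/(_ j k) := rN.
  rewrite mul_diag_mx mul_mx_diag !mxE ci !mxE [RHS]mulrC => /eqP.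
  rewrite -subr_eq0 -mulrBr.
  rewrite mulf_eq0 subr_eq0 => /orP[/eqP//|].
  by have := ki; rewrite -(inj_eq regular_inj) !mxE => /negPf->.
have NMij : N j i * M i j = 1.
  have /matrixP/(_ j j) := NM; rewrite !mxE eqxx (bigD1 i) //= big1 ?addr0 //.
  by move=> k ki; rewrite N0 // mul0r.
exists i => f.
have -> : (f *m e) 0 j = (f *m e') 0 i * M i j.
  rewrite eM mulmxA mxE (bigD1 i) //= big1 ?addr0 //.
  by move=> k ki; rewrite M0 // mulr0.
have -> : (invmx (map_mx h e) *m x) j 0 =
    h (N j i) * (invmx (map_mx h e') *m x) i 0.
  rewrite xN mxE (bigD1 i) //= mxE big1 ?addr0 // => k ki.
  by rewrite mxE N0 // rmorph0 mul0r.
by rewrite mulrA -rmorphM -mulrA [M i j * _]mulrC NMij mulr1.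
Qed.

End Tori.

(** * Polynomials vanishing on infinite grids *)

Section PolynomialsOnGrids.

Variables (n : nat) (K : fieldType).

Lemma meval_map_mpoly (F : fieldType) (h : {rmorphism F -> K}) (x : 'I_n -> F)
    (p : {mpoly F[n]}) :
  meval (fun i => h (x i)) (map_mpoly h p) = h (meval x p).
Proof.
rewrite mevalE (perm_big _ (msupp_map_mpoly p (fmorph_inj h))) /= mevalE rmorph_sum.
apply: eq_bigr => m _; rewrite mcoeff_map_mpoly rmorphM rmorph_prod.
by congr (_ * _); apply: eq_bigr => i _; rewrite rmorphXn.
Qed.

Lemma poly_infinite_roots (a : nat -> K) (p : {poly K}) :
  injective a -> (forall k, p.[a k] = 0) -> p = 0.
Proof.
move=> inj_a pa0; apply/eqP/negPn/negP => p0.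
have := max_poly_roots p0 (rs := [seq a k | k <- iota 0 (size p)]).
rewrite size_map size_iota ltnn map_inj_uniq ?iota_uniq // => /(_ _ isT) H.
suff /H : all (root p) [seq a k | k <- iota 0 (size p)] by [].
by apply/allP => _ /mapP[k _ ->]; apply/eqP/pa0.
Qed.

(** Coordinates are freed one at a time: with the others fixed, a polynomial in one variable has
    infinitely many roots. *)
Lemma grid_eq0 (a : nat -> K) (p : {mpoly K[n]}) : injective a ->
  (forall s : 'I_n -> nat, meval (fun i => a (s i)) p = 0) ->
  forall x, meval x p = 0.
Proof.
move=> inj_a pa0 x.
(* Coordinates of index below [m] are arbitrary, the others lie in the grid. *)
suff H m : (m <= n)%N -> forall x : 'I_n -> K,
    (forall i : 'I_n, (m <= i)%N -> exists s, x i = a s) -> meval x p = 0.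
  by apply: (H n) => // i; rewrite leqNgt ltn_ord.
elim: m => [|m IH] mn {}x xa.
  have /choice[s sE] : forall i, exists s, x i = a s by move=> i; apply: xa.
  by rewrite (meval_eq _ sE).
pose im := Ordinal mn.
pose P : {poly K} :=
  \sum_(k <- msupp p) (p@_k)%:P *
    \prod_i (if i == im then 'X else (x i)%:P) ^+ k i.
have PE t : P.[t] = meval (fun i => if i == im then t else x i) p.
  rewrite mevalE horner_sum; apply: eq_bigr => k _.
  rewrite hornerM hornerC horner_prod; congr (_ * _); apply: eq_bigr => i _.
  by rewrite horner_exp; case: eqP => _; rewrite ?hornerX ?hornerC.
have P0 : P = 0.
  apply: (poly_infinite_roots inj_a) => k; rewrite PE; apply: IH => [|i mi].
    exact: ltnW.
  case: eqP => [_|ne]; first by exists k.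
  apply: xa; rewrite ltn_neqAle mi andbT; apply/eqP => mE.
  by apply: ne; apply: val_inj.
have -> : meval x p = P.[x im]; last by rewrite P0 horner0.
by rewrite PE; apply: meval_eq => i; case: eqP => [->|].
Qed.

(** Substituting linear forms reduces to the whole space. A singular [A] gives access to the points
    of a hyperplane. *)
Lemma grid_linear_eq0 (a : nat -> K) (A : 'M[K]_n) (p : {mpoly K[n]}) :
  injective a ->
  (forall s : 'I_n -> nat,
     meval (fun i => (A *m \col_j a (s j)) i 0) p = 0) ->
  forall y : 'cV_n, meval (fun i => (A *m y) i 0) p = 0.
Proof.
move=> inj_a pa0 y.
pose L := [tuple \sum_j A i j *: 'X_j | i < n] : n.-tuple {mpoly K[n]}.
have LE (z : 'cV_n) : meval (fun i => (A *m z) i 0) p = meval (fun i => z i 0) (p \mPo L).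
  rewrite comp_mpoly_meval; apply: meval_eq => i; rewrite tnth_mktuple mxE raddf_sum.
  by apply: eq_bigr => j _; rewrite /= mevalZ mevalXU.
rewrite LE; apply: (grid_eq0 inj_a) => s; rewrite -(pa0 s) LE; apply: meval_eq => i.
by rewrite mxE.
Qed.

End PolynomialsOnGrids.

(** * Torus-invariant sections and stable points *)

Section Sections.

Variables (R : realType) (F : fieldType) (v : F -> R) (q : R) (pi : F) (n N : nat).
Hypotheses (hv : is_valuation v) (hq : 1 < q) (pi0 : pi != 0) (vpi : v pi = 1).
Hypotheses (n_gt0 : (0 < n)%N) (N_gt0 : (0 < N)%N) (n_dvd_N : (n %| N)%N).

Lemma ext_valuation (K : cc_extension v) : is_valuation (@ext_val _ _ _ K).
Proof. by case: K. Qed.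

Lemma ext_abs_inj (K : cc_extension v) a :
  ext_abs q (@ext_inj _ _ _ K a) = vabs q v a.
Proof.
case: K => K h w hw wE hc; rewrite /ext_abs /vabs /= fmorph_eq0.
by case: eqP => // /eqP/wE->.
Qed.

Definition hyperplane_proj (K : fieldType) (i : 'I_n) : 'M[K]_n :=
  diag_mx (\row_j (j != i)%:R).

Lemma hyperplane_projE (K : fieldType) i (y : 'cV[K]_n) j :
  (hyperplane_proj K i *m y) j 0 = if j == i then 0 else y j 0.
Proof. by rewrite mul_diag_mx !mxE; case: eqP => _; rewrite ?mul0r ?mul1r. Qed.

Variable T : set 'M[F]_n.

(* The element of [T] scaling the [i]-th coordinate by [pi] fixes [x], while its
   determinant factor in the invariance is a nontrivial power of [pi]. *)
Lemma inv_section_eq0 e e0 k f (x : 'cV[F]_n) (i : 'I_n) :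
  max_split_torus T -> diagonalizes e T -> (0 < k)%N ->
  inv_section N T e0 k f -> (invmx e *m x) i 0 = 0 -> peval e0 f x = 0.
Proof.
move=> Tmax dT k0 [_ finv] xi0; have [uE _] := dT.
pose d : 'rV[F]_n := \row_j (if j == i then pi else 1).
have d0 j : d 0 j != 0 by rewrite mxE; case: ifP => // _; apply: oner_neq0.
pose t := e *m diag_mx d *m invmx e.
have Tt : T t := max_split_torus_full Tmax dT d0.
have ut : t \in unitmx by case: Tmax => -[Tu _ _ _ _] _; apply: Tu.
have dx : diag_mx d *m (invmx e *m x) = invmx e *m x.
  apply/colP => j; rewrite mul_diag_mx mxE [d _ _]mxE.
  by case: eqP => [->|_]; rewrite ?mul1r // xi0 mulr0.
have tx : invmx t *m x = x.
  apply: (can_inj (mulKmx ut)); rewrite mulKVmx //.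
  by rewrite /t -!mulmxA dx mulKVmx.
have dett : \det t = pi.
  rewrite !det_mulmx det_inv mulrAC divff ?mul1r -?unitfE -?unitmxE //.
  rewrite det_diag (bigD1 i) //= mxE eqxx big1 ?mulr1 // => j ji.
  by rewrite mxE (negPf ji).
have := finv t Tt x; rewrite tx dett => /eqP.
rewrite -subr_eq0 -{2}[peval _ _ _]mul1r -mulrBl mulf_eq0 => /orP[|/eqP//].
(* [pi ^+ m = 1] forces [m = 0], while the exponent [(k * N) %/ n] is positive because [n] divides
   [N]. *)
rewrite subr_eq0 -(expr0 pi) => /eqP/(uniformizer_exp_inj hv pi0 vpi)/eqP.
by rewrite -leqn0 leqNgt divn_gt0 // dvdn_leq // ?muln_gt0 ?k0 // dvdn_mull.
Qed.

Variable K : cc_extension v.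

Lemma ext_unitmx m (A : 'M[F]_m) : (ext_mx K A \in unitmx) = (A \in unitmx).
Proof. by rewrite /ext_mx map_unitmx. Qed.

(** Invariance gives vanishing at the [F]-points of the hyperplane; those with powers of [pi] as
    coordinates form a grid, from which vanishing spreads to the [K]-points. *)
Lemma inv_section_ext_eq0 e e0 k f (x : 'cV[K]_n) (i : 'I_n) :
  e0 \in unitmx -> max_split_torus T -> diagonalizes e T -> (0 < k)%N ->
  inv_section N T e0 k f -> (invmx (ext_mx K e) *m x) i 0 = 0 ->
  ext_peval e0 f x = 0.
Proof.
move=> ue0 Tmax dT k0 fS xi0; have [uE _] := dT.
pose h := @ext_inj _ _ _ K.
pose D := hyperplane_proj K i.
have Dx : D *m (invmx (ext_mx K e) *m x) = invmx (ext_mx K e) *m x.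
  by apply/colP => j; rewrite hyperplane_projE; case: eqP => // ->.
rewrite /ext_peval -(mulKVmx (_ : ext_mx K e \in unitmx) x) ?ext_unitmx // -Dx.
move: (_ *m x) => y; rewrite !mulmxA.
apply: (@grid_linear_eq0 _ _ (fun l => h (pi ^+ l))).
  by apply: inj_comp; [exact: fmorph_inj | exact: (uniformizer_exp_inj hv pi0 vpi)].
move=> s; pose z : 'cV[F]_n := \col_j pi ^+ s j.
have -> : \col_j h (pi ^+ s j) = map_mx h z by apply/colP => j; rewrite !mxE.
have -> : D = map_mx h (hyperplane_proj F i).
  by apply/matrixP => j l; rewrite !mxE rmorphMn /= rmorph_nat.
rewrite /ext_mx -map_invmx -!map_mxM.
transitivity (meval (fun j => h ((invmx e0 *m (e *m (hyperplane_proj F i *m z))) j 0))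
                (map_mpoly h f)).
  by apply: meval_eq => j; rewrite !mulmxA mxE.
rewrite meval_map_mpoly; apply/eqP; rewrite fmorph_eq0; apply/eqP.
apply: (inv_section_eq0 Tmax dT k0 fS (i := i)).
by rewrite mulKmx // hyperplane_projE eqxx.
Qed.

(** Monomials free of the [i]-th variable cancel; the others vanish at the projected point and are
    [y i 0] times an integral factor at [y]. *)
Lemma integral_meval_lipschitz (p : {mpoly F[n]}) (y : 'cV[K]_n) (i : 'I_n) :
  (forall m, vabs q v p@_m <= 1) -> (forall j, ext_abs q (y j 0) <= 1) ->
  ext_abs q (meval (fun j => y j 0) (map_mpoly (@ext_inj _ _ _ K) p) -
    meval (fun j => (hyperplane_proj K i *m y) j 0) (map_mpoly (@ext_inj _ _ _ K) p))
  <= ext_abs q (y i 0).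
Proof.
have hw := ext_valuation K.
move=> p1 y1; rewrite !mevalE -sumrB.
apply: (vabs_sum_le hw hq) => [|m]; first exact: vabs_ge0.
rewrite -mulrBr (vabsM hw hq) mcoeff_map_mpoly.
rewrite -[leRHS]mul1r ler_pM ?vabs_ge0 //; first by rewrite -/(ext_abs q _) ext_abs_inj.
have [mi0|mi_gt0] := posnP (m i).
  rewrite [X in _ - X](_ : _ = \prod_j y j 0 ^+ m j) ?subrr ?vabs0 ?vabs_ge0 //.
  apply: eq_bigr => j _; rewrite hyperplane_projE; case: eqP => // ->.
  by rewrite mi0 !expr0.
rewrite [X in _ - X](bigD1 i) //= hyperplane_projE eqxx expr0n gtn_eqF // mul0r subr0.
rewrite (vabs_prod hw hq) (bigD1 i) //= -[leRHS]mulr1 ler_pM ?vabs_ge0 ?prodr_ge0 //.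
- by move=> j _; apply: vabs_ge0.
- rewrite (vabsX hw hq) -(prednK mi_gt0) exprS -[leRHS]mulr1 ler_wpM2l ?vabs_ge0 //.
  by rewrite exprn_ile1 ?vabs_ge0 //; apply: y1.
apply: prodr_ile1 => j; rewrite vabs_ge0 (vabsX hw hq) exprn_ile1 ?vabs_ge0 //.
exact: y1.
Qed.

(** The section with unit value at [y] vanishes once the [i]-th coordinate is set to 0, so by the
    Lipschitz bound this coordinate has absolute value at least 1. *)
Lemma integral_stable_unit e (y : 'cV[K]_n) i :
  max_split_torus T -> diagonalizes e T -> integral_stable q N T e y ->
  ext_abs q ((invmx (ext_mx K e) *m y) i 0) = 1.
Proof.
move=> Tmax dT [y1 _ [k [f [k0 fS f1 fy]]]]; have [uE _] := dT.
apply/le_anti; rewrite y1 /= -fy /ext_peval.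
pose y' := ext_mx K e *m (hyperplane_proj K i *m (invmx (ext_mx K e) *m y)).
have y'E : invmx (ext_mx K e) *m y' = hyperplane_proj K i *m (invmx (ext_mx K e) *m y).
  by rewrite mulKmx // ext_unitmx.
have fy' : ext_peval e f y' = 0.
  apply: (inv_section_ext_eq0 uE Tmax dT k0 fS (i := i)).
  by rewrite y'E hyperplane_projE eqxx.
have := integral_meval_lipschitz i f1 y1.
by rewrite -y'E [X in _ - X]fy' subr0.
Qed.

(** The exponent makes the total degree [N]. For [A = invmx e *m e0] the factors are powers of the
    coordinates in [e], expressed in those of [e0]. *)
Definition coord_product (A : 'M[F]_n) : {mpoly F[n]} :=
  \prod_i (\sum_j A i j *: 'X_j) ^+ (N %/ n).

Lemma coord_product_homog A : coord_product A \is (1 * N).-homog.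
Proof.
have linX i : (\sum_j A i j *: 'X_j) ^+ (N %/ n) \is (N %/ n).-homog.
  rewrite -[X in X.-homog]mul1n; apply: dhomogMn.
  by apply: rpred_sum => j _; apply: dhomogZ; rewrite dhomogX /= mdeg1.
have H (s : seq 'I_n) :
    \prod_(i <- s) (\sum_j A i j *: 'X_j) ^+ (N %/ n) \is (N %/ n * size s).-homog.
  elim: s => [|i s IH]; first by rewrite big_nil muln0 dhomog1.
  by rewrite big_cons mulnS; apply: dhomogM.
have := H (enum 'I_n); rewrite size_enum_ord divnK // big_enum mul1n.
exact.
Qed.

Lemma meval_linear_form m (L : fieldType) (c x : 'I_m -> L) :
  meval x (\sum_j c j *: 'X_j) = \sum_j c j * x j.
Proof. by rewrite raddf_sum; apply: eq_bigr => j _; rewrite /= mevalZ mevalXU. Qed.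

Lemma map_linear_form m (L L' : fieldType) (h : {rmorphism L -> L'}) (c : 'I_m -> L) :
  map_mpoly h (\sum_j c j *: 'X_j) = \sum_j h (c j) *: 'X_j.
Proof.
by rewrite raddf_sum; apply: eq_bigr => j _; rewrite /= map_mpolyZ map_mpolyX.
Qed.

Lemma coord_product_peval e e0 (x : 'cV[F]_n) : e0 \in unitmx ->
  peval e0 (coord_product (invmx e *m e0)) x = \prod_i (invmx e *m x) i 0 ^+ (N %/ n).
Proof.
move=> u0; rewrite /peval rmorph_prod; apply: eq_bigr => i _.
rewrite rmorphXn /= meval_linear_form; congr (_ ^+ _).
by rewrite -[in RHS](mulKVmx u0 x) (mulmxA (invmx e)) [RHS]mxE.
Qed.

Lemma coord_product_ext_peval e e0 (x : 'cV[K]_n) : e0 \in unitmx ->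
  ext_peval e0 (coord_product (invmx e *m e0)) x =
  \prod_i (invmx (ext_mx K e) *m x) i 0 ^+ (N %/ n).
Proof.
move=> u0; rewrite /ext_peval !rmorph_prod; apply: eq_bigr => i _.
rewrite !rmorphXn /=; congr (_ ^+ _).
rewrite -[in RHS](mulKVmx (_ : ext_mx K e0 \in unitmx) x) ?ext_unitmx //.
rewrite (mulmxA (invmx (ext_mx K e))).
rewrite /ext_mx -(map_invmx _ e) -map_mxM [RHS]mxE map_linear_form.
by rewrite meval_linear_form; apply: eq_bigr => j _; rewrite [in RHS]mxE.
Qed.

(** [invmx t] divides the coordinates by the eigenvalues of [t], and the linearization restores the
    power [N %/ n] of their product [\det t]. *)
Lemma coord_product_inv_section e e0 : e0 \in unitmx -> diagonalizes e T ->
  (forall t, T t -> t \in unitmx) ->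
  inv_section N T e0 1 (coord_product (invmx e *m e0)).
Proof.
move=> u0 [uE dT] uT; split=> [|t Tt x]; first exact: coord_product_homog.
rewrite !coord_product_peval // mul1n.
have /diag_mxP[d dE] := dT _ Tt; have ut := uT _ Tt.
have tE : t = e *m diag_mx d *m invmx e.
  by rewrite -dE !mulmxA mulmxV // mul1mx mulmxK.
have -> : \det t = \prod_i d 0 i.
  by rewrite tE !det_mulmx det_inv mulrAC divff ?mul1r ?det_diag // -unitfE -unitmxE.
rewrite -prodrXl -big_split /=; apply: eq_bigr => i _; rewrite -exprMn; congr (_ ^+ _).
have -> : invmx e *m x = diag_mx d *m (invmx e *m (invmx t *m x)).
  by rewrite -{1}(mulKVmx ut x) {1}tE -!mulmxA mulKmx.
by rewrite mul_diag_mx [RHS]mxE.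
Qed.

(** Invariant sections vanish on every coordinate hyperplane of [T], and the product of the
    coordinates vanishes only there. *)
Lemma stableP e (x : 'cV[K]_n) : max_split_torus T -> diagonalizes e T ->
  stable N T x <-> forall i, (invmx (ext_mx K e) *m x) i 0 != 0.
Proof.
move=> Tmax dT; split=> [[k [f [k0 fS fx]]] i|x0].
  by apply: contraNneq fx => /(inv_section_ext_eq0 (unitmx1 _ _) Tmax dT k0 fS)->.
exists 1%N, (coord_product (invmx e *m 1%:M)); split=> //.
  by apply: coord_product_inv_section; rewrite ?unitmx1 //; case: Tmax => -[].
rewrite coord_product_ext_peval ?unitmx1 //.
by apply/prodf_neq0 => i _; rewrite expf_neq0.
Qed.

Lemma integral_stable1 e : max_split_torus T -> diagonalizes e T ->
  integral_stable q N T e (ext_mx K e *m const_mx 1).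
Proof.
move=> Tmax dT; have [uE _] := dT; have hw := ext_valuation K.
have abs1 : ext_abs q (1 : K) = 1 by apply: vabs1.
have E : invmx (ext_mx K e) *m (ext_mx K e *m const_mx 1) = const_mx 1 :> 'cV_n.
  by rewrite mulKmx // ext_unitmx.
rewrite /integral_stable E; split=> [i||].
- by rewrite mxE abs1.
- by exists (Ordinal n_gt0); rewrite mxE abs1.
exists 1%N, (coord_product (invmx e *m e)); split=> //.
- by apply: coord_product_inv_section => //; case: Tmax => -[].
(* In its own basis the coordinate product is a monomial, with coefficients 0 and 1. *)
- move=> m; have -> : coord_product (invmx e *m e) = 'X_[[multinom (N %/ n)%N | i < n]].
    rewrite mulVmx // mpolyXE_id; apply: eq_bigr => i _; rewrite mnmE; congr (_ ^+ _).
    rewrite (bigD1 i) //= mxE eqxx scale1r big1 ?addr0 // => j ji.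
    by rewrite mxE eq_sym (negPf ji) scale0r.
  by rewrite mcoeffX; case: eqP => _; rewrite ?vabs0 ?ler01 // vabs1.
rewrite coord_product_ext_peval // E big1 // => i _; rewrite mxE expr1n //.
Qed.

End Sections.

(** * The retractions *)

Lemma homothety_classZ (R : realType) (F : fieldType) n (al be : 'rV[F]_n -> R) c :
  0 < c -> (forall f, al f = c * be f) -> homothety_class al = homothety_class be.
Proof.
move=> c0 alE; apply/seteqP; split=> g [b b0 gE].
  by exists (b * c) => [|f]; [exact: mulr_gt0 | rewrite gE alE mulrA].
exists (b / c) => [|f]; first exact: divr_gt0.
by rewrite gE alE mulrA mulfVK ?gt_eqF.
Qed.

(** Makes any rational hyperplane a coordinate hyperplane of some torus: [f] replaces a row of the
    identity at an index where it is nonzero. *)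
Lemma unitmx_with_row (F : fieldType) n (f : 'rV[F]_n) : f != 0 ->
  exists2 A : 'M[F]_n, A \in unitmx & exists i, row i A = f.
Proof.
move=> /rV0Pn[j fj].
pose A : 'M[F]_n := \matrix_(i, k) if i == j then f 0 k else (i == k)%:R.
exists A; last by exists j; apply/rowP => k; rewrite !mxE eqxx.
rewrite -row_free_unit; apply: inj_row_free => c /rowP cA.
have cE k : (c *m A) 0 k = c 0 j * f 0 k + (k != j)%:R * c 0 k.
  rewrite mxE (bigD1 j) //= mxE eqxx; congr (_ + _).
  have [->|kj] := eqVneq k j; last rewrite (bigD1 k) //= mxE (negPf kj) eqxx mulr1 mul1r.
    by rewrite mul0r big1 // => i ij; rewrite mxE (negPf ij) mulr0.
  by rewrite big1 ?addr0 // => i /andP[ij ik]; rewrite mxE (negPf ij) (negPf ik) mulr0.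
have cj : c 0 j = 0.
  have /eqP := cA j; rewrite cE eqxx mul0r addr0 mxE mulf_eq0 (negPf fj) orbF.
  by move/eqP.
apply/rowP => k; rewrite mxE; have [->//|kj] := eqVneq k j.
by have := cA k; rewrite cE cj mul0r add0r kj mul1r mxE.
Qed.

(** * The Drinfeld space and the comparison of retractions *)

Section DrinfeldSpace.

Variables (R : realType) (F : fieldType) (v : F -> R) (q : R) (pi : F) (n N : nat).
Hypotheses (hv : is_valuation v) (hq : 1 < q) (pi0 : pi != 0) (vpi : v pi = 1).
Hypotheses (n_gt0 : (0 < n)%N) (N_gt0 : (0 < N)%N) (n_dvd_N : (n %| N)%N).
Implicit Types (x : geom_point v n) (e : 'M[F]_n) (T : set 'M[F]_n).
Implicit Types xi : set ({mpoly F[n]} -> R).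

Definition eval_norm x (f : 'rV[F]_n) : R :=
  ext_abs q ((ext_mx (gp_ext x) f *m gp_vec x) 0 0).

Definition torus_coord e x i : gp_ext x :=
  (invmx (ext_mx (gp_ext x) e) *m gp_vec x) i 0.

(** Represents the retraction of [x] to the apartment. The product stays inside [ext_abs] to match
    [eigenline_term]. *)
Definition torus_norm e x (f : 'rV[F]_n) : R :=
  \big[Num.max/0]_(i < n)
    ext_abs q (@ext_inj _ _ _ (gp_ext x) ((f *m e) 0 i) * torus_coord e x i).

Lemma torus_normE e x f : torus_norm e x f =
  \big[Num.max/0]_(i < n) (vabs q v ((f *m e) 0 i) * ext_abs q (torus_coord e x i)).
Proof.
apply: eq_bigr => i _; rewrite /ext_abs (vabsM (ext_valuation _) hq).
by rewrite -/(ext_abs q _) ext_abs_inj.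
Qed.

(** By [eigenline_term] each term of one maximum occurs in the other, which gives both
    inequalities. *)
Lemma torus_norm_indep T e e' x :
  max_split_torus T -> diagonalizes e T -> diagonalizes e' T ->
  torus_norm e x = torus_norm e' x.
Proof.
move=> Tmax; have le e1 e2 f : diagonalizes e1 T -> diagonalizes e2 T ->
    torus_norm e1 x f <= torus_norm e2 x f.
  move=> d1 d2; apply: le_bigmax0 => [|j]; first exact: bigmax0_ge0.
  have [i iE] := eigenline_term hv pi0 vpi (@ext_inj _ _ _ (gp_ext x))
    (gp_vec x) j Tmax d1 d2.
  rewrite [X in ext_abs q X]iE.
  exact: (le_bigmax _ (fun i => ext_abs q (_ * torus_coord e2 x i))).
by move=> d1 d2; apply/funext => f; apply/le_anti; rewrite !le.
Qed.

Lemma torus_coord_eval e x i :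
  torus_coord e x i = (ext_mx (gp_ext x) (row i (invmx e)) *m gp_vec x) 0 0.
Proof.
rewrite /torus_coord /ext_mx -map_invmx !mxE.
by apply: eq_bigr => j _; rewrite !mxE.
Qed.

Lemma torus_norm_apt e x (d : 'rV[gp_ext x]_n) (y : 'cV[gp_ext x]_n) :
  e \in unitmx -> (forall i, d 0 i != 0) ->
  (forall i, ext_abs q ((invmx (ext_mx (gp_ext x) e) *m y) i 0) = 1) ->
  gp_vec x = torus_mx e d *m y ->
  torus_norm e x = apt_norm v q e (fun i => - ext_val (d 0 i)).
Proof.
move=> uE d0 y1 xE; apply/funext => f; rewrite torus_normE.
apply: eq_bigr => i _; congr (_ * _).
rewrite /torus_coord xE /torus_mx -!mulmxA mulKmx ?ext_unitmx // mul_diag_mx mxE.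
rewrite /ext_abs (vabsM (ext_valuation _) hq) -/(ext_abs q (_ i 0)) y1 mulr1.
by rewrite vabs_def.
Qed.

Lemma retracts_toP T x z : max_split_torus T -> retracts_to q N T x z ->
  exists2 e, diagonalizes e T & z = homothety_class (torus_norm e x).
Proof.
move=> Tmax [e [d [y [dT d0 yS xE ->]]]]; exists e => //.
rewrite (torus_norm_apt _ d0 _ xE) //; first by case: dT.
by move=> i; apply: (integral_stable_unit hv hq pi0 vpi n_gt0 N_gt0 n_dvd_N i Tmax dT yS).
Qed.

Lemma retracts_to_torus_norm T e x : max_split_torus T -> diagonalizes e T ->
  (forall i, torus_coord e x i != 0) ->
  retracts_to q N T x (homothety_class (torus_norm e x)).
Proof.
move=> Tmax dT x0; have [uE _] := dT.
(* In [x = t y], the torus element carries the coordinates of [x] and [y] has all coordinates 1. *)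
pose d := \row_i torus_coord e x i; pose y : 'cV_n := ext_mx (gp_ext x) e *m const_mx 1.
have d0 i : d 0 i != 0 by rewrite mxE.
have xE : gp_vec x = torus_mx e d *m y.
  rewrite /torus_mx -!mulmxA mulKmx ?ext_unitmx //.
  rewrite -[LHS](mulKVmx (_ : ext_mx (gp_ext x) e \in unitmx)) ?ext_unitmx //.
  congr (_ *m _); apply/colP => i; rewrite mul_diag_mx mxE [const_mx _ _ _]mxE.
  by rewrite [d _ _]mxE mulr1.
exists e, d, y; split=> //; first exact: integral_stable1.
rewrite (torus_norm_apt uE d0 _ xE) // => i.
rewrite /y mulKmx ?ext_unitmx // mxE /ext_abs vabs1 //; exact: ext_valuation.
Qed.

(** Linear forms have degree 1, where seminorms of one class differ by the factor [c] itself. *)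
Lemma berk_point_eval x x' : berk_point q x = berk_point q x' ->
  exists2 c : R, 0 < c & forall f, eval_norm x f = c * eval_norm x' f.
Proof.
move=> xx'; pose s f := ext_abs q (ext_peval 1%:M f (gp_vec x)).
have : berk_point q x s by exists 1 => // d f _; rewrite expr1n mul1r.
rewrite xx' => -[c c0 sE]; exists c => // f.
pose p : {mpoly F[n]} := \sum_j f 0 j *: 'X_j.
have pE (z : geom_point v n) :
    ext_peval 1%:M p (gp_vec z) = (ext_mx (gp_ext z) f *m gp_vec z) 0 0.
  rewrite /ext_peval /ext_mx map_mx1 invmx1 map_linear_form meval_linear_form mxE.
  by apply: eq_bigr => j _; rewrite mul1mx mxE.
have ph : p \is 1.-homog.
  by apply: rpred_sum => j _; apply: dhomogZ; rewrite dhomogX /= mdeg1.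
by have := sE _ _ ph; rewrite /s !pE expr1.
Qed.

Lemma berk_point_torus_norm x x' e : berk_point q x = berk_point q x' ->
  homothety_class (torus_norm e x) = homothety_class (torus_norm e x').
Proof.
move=> /berk_point_eval[c c0 xE]; apply: (homothety_classZ c0) => f.
rewrite !torus_normE -bigmax0Ml ?ltW //; apply: eq_bigr => i _.
by rewrite !torus_coord_eval -/(eval_norm _ _) xE mulrCA.
Qed.

Lemma omega_torus_coord x e i : omega v q n (berk_point q x) -> e \in unitmx ->
  torus_coord e x i != 0.
Proof.
move=> [_ H] uE; rewrite torus_coord_eval.
have := H x erefl (row i (invmx e)); rewrite row_unitmx_neq0 ?unitmx_inv //.
move=> /(_ isT); apply: contra => /eqP E; apply/eqP/matrixP => a b.
by rewrite !ord1 E mxE.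
Qed.

(** By [stableP] stability means avoiding coordinate hyperplanes, and each rational hyperplane is
    one for some maximal torus. *)
Lemma stable_locus_omega : stable_locus v q n N = omega v q n.
Proof.
apply/seteqP; split=> xi [xi_berk H]; split=> //.
  move=> x xiE f f0; have [A uA [i iA]] := unitmx_with_row f0.
  have uA' : invmx A \in unitmx by rewrite unitmx_inv.
  have dT : diagonalizes (invmx A) (diag_torus (invmx A)) by split=> // t [].
  have Tmax := diag_torus_max hv pi0 vpi uA'.
  have [_ /(_ x xiE)] := H _ Tmax.
  move/(stableP hv pi0 vpi n_gt0 N_gt0 n_dvd_N _ Tmax dT)/(_ i).
  rewrite -/(torus_coord _ _ _) torus_coord_eval invmxK iA.
  by apply: contra => /eqP->; rewrite mxE.
move=> T Tmax; split=> // x xiE; have [[_ _ _ _ [e dT]] _] := Tmax.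
apply/(stableP hv pi0 vpi n_gt0 N_gt0 n_dvd_N _ Tmax dT) => i.
by apply: omega_torus_coord; [split; rewrite -xiE | case: dT].
Qed.

Lemma eval_norm_is_norm x : omega v q n (berk_point q x) -> is_norm v q (eval_norm x).
Proof.
move=> [_ H]; have hw := ext_valuation (gp_ext x).
rewrite /eval_norm; split=> [f|f|a f|f g].
- exact: vabs_ge0.
- split=> [/eqP|->]; last by rewrite /ext_mx map_mx0 mul0mx mxE /ext_abs vabs0.
  rewrite /ext_abs vabs_eq0 // => fx0; apply/eqP/negPn/negP => f0.
  have /negP := H x erefl f f0; apply; apply/eqP/matrixP => a b.
  by rewrite !ord1 (eqP fx0) mxE.
- rewrite /ext_mx map_mxZ -scalemxAl mxE /ext_abs (vabsM hw hq).
  by rewrite -/(ext_abs q _) ext_abs_inj.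
- by rewrite /ext_mx map_mxD mulmxDl mxE; apply: vabsD.
Qed.

(** The set from which [get] picks is a singleton: the class depends neither on the representative
    of the Berkovich point nor on the basis. *)
Lemma apt_retractionE T e x : omega v q n (berk_point q x) ->
  max_split_torus T -> diagonalizes e T ->
  apt_retraction v q N T (berk_point q x) = homothety_class (torus_norm e x).
Proof.
move=> xO Tmax dT; apply: get_unique.
  exists x => //; apply: retracts_to_torus_norm => // i.
  by apply: omega_torus_coord => //; case: dT.
move=> z [x' xE /(retracts_toP Tmax)[e' dT' ->]].
by rewrite (torus_norm_indep x' Tmax dT' dT) (berk_point_torus_norm e xE).
Qed.

(** A norm of the apartment is determined by its values on the dual basis of [e]; those of
    [eval_norm x] are the absolute values of the coordinates of [x], which are the weights in
    [torus_norm e x]. *)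
Lemma apt_point_torus_norm e la x : e \in unitmx ->
  homothety_class (eval_norm x) = apt_point v q e la ->
  homothety_class (torus_norm e x) = homothety_class (eval_norm x).
Proof.
move=> uE xE; have : homothety_class (eval_norm x) (eval_norm x).
  by exists 1 => // f; rewrite mul1r.
rewrite {1}xE => -[c c0 evE]; congr homothety_class; apply/funext => f.
rewrite torus_normE evE /apt_norm -bigmax0Ml ?ltW //; apply: eq_bigr => i _.
rewrite mulrCA; congr (_ * _).
rewrite torus_coord_eval -/(eval_norm _ _) evE /apt_norm -row_mul mulVmx //; congr (_ * _).
apply/le_anti/andP; split.
  apply: le_bigmax0 => [|j]; first exact: powR_ge0.
  rewrite !mxE; case: eqP => [->|_]; first by rewrite vabs1 // mul1r.
  by rewrite vabs0 mul0r powR_ge0.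
by apply: (bigmax_sup i) => //; rewrite !mxE eqxx vabs1 // mul1r.
Qed.

Hypothesis vZ : forall a, a != 0 -> exists k : int, v a = k%:~R.
Hypothesis vc : val_complete v.

Lemma retractionE x : omega v q n (berk_point q x) ->
  retraction v q N (berk_point q x) = homothety_class (eval_norm x).
Proof.
move=> xO; have ev := eval_norm_is_norm xO.
have apt T : max_split_torus T -> apartment v q T (homothety_class (eval_norm x)) ->
    apt_retraction v q N T (berk_point q x) = homothety_class (eval_norm x).
  move=> Tmax [e [la [dT xE]]]; rewrite (apt_retractionE xO Tmax dT).
  by apply: apt_point_torus_norm xE; case: dT.
apply: get_unique.
  split; first by exists (eval_norm x).
  by split; [rewrite stable_locus_omega | exact: apt].
(* In an apartment containing both classes, the retraction of [x] is that of [be] by the fiber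
   condition and that of [eval_norm x] by [apt]. *)
move=> _ [[be hbe ->] [_ H]].
have [e [la [mu [uE xE beE]]]] := common_apartment hv hq vZ vc ev hbe.
have Tmax := diag_torus_max hv pi0 vpi uE.
have dT : diagonalizes e (diag_torus e) by split=> // t [].
rewrite -(H _ Tmax); last by exists e, mu; rewrite {1}beE.
by apply: apt => //; exists e, la; rewrite {1}xE.
Qed.

Lemma drinfeld_retractionE x :
  drinfeld_retraction v q (berk_point q x) = homothety_class (eval_norm x).
Proof.
apply/seteqP; split=> [be [x' xE]|be beE]; last by exists x.
have [c c0 evE] := berk_point_eval xE.
by rewrite -/(eval_norm x') (homothety_classZ c0 evE).
Qed.

End DrinfeldSpace.

Theorem proposition5p15 (R : realType) (p : nat) (Qp : fieldType)
    (vp : Qp -> R) (F : fieldExtType Qp) (v : F -> R) (q : R) (n N : nat)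
    (hp : prime p) (hQp : is_padic_field p vp)
    (hv : is_normalized_extension vp v) (hq : 1 < q)
    (hn : (2 <= n)%N) (hN : (0 < N)%N) (hnN : (n %| N)%N) :
  stable_locus v q n N = omega v q n /\
  forall xi, omega v q n xi ->
    retraction v q N xi = drinfeld_retraction v q xi.
Proof.
have [vpv _ _ vpc] := hQp; have [vv vZ [pi pi0 vpi] _] := hv.
have vc := normalized_extension_complete hq vpv vpc hv.
have n0 := ltnW hn.
split; first exact: (stable_locus_omega q vv pi0 vpi).
move=> xi xiO; have [[x xiE] _] := xiO; rewrite xiE in xiO *.
rewrite (retractionE vv hq pi0 vpi n0 hN hnN vZ vc xiO).
by rewrite drinfeld_retractionE.
Qed.
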